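(* Let $n\ge 1$ and $m\ge 2$. For metric sequential transportation games with $n$ players and $m$ buses, $\mathrm{SPoS}(U)\ge 2\frac{n}{m}-1$, even when restricted to games in which all buses have the same permutation. That is, if $\mathcal{G}$ is the class of metric sequential transportation games with $n$ players and $m$ buses in which $\pi_1=\dots=\pi_m$, then $\mathrm{SPoS}(U,\mathcal{G})\ge 2\frac{n}{m}-1$.
   Context: Transportation game. An instance $\Gamma$ consists of a set of players $N=\{1,\dots,n\}$ ($n\ge 1$), a set of buses $M=\{1,\dots,m\}$ with $m\ge 2$, a complete undirected graph on the vertex set $V=N\cup\{s,t\}$ ($s$ the source, $t$ the destination) with a distance function $d$ assigning a nonnegative real $d(x,y)=d(y,x)$ to each edge (with $d(x,x)=0$), and for each bus $j\in M$ a permutation $\pi_j$ of $N$. The instance is metric if $d(x,w)\le d(x,y)+d(y,w)$ for all $x,y,w\in V$. Distances between distinct vertices may be $0$. An outcome is a map $\sigma:N\to M$, $\sigma_i$ being the bus chosen by player $i$; $\mathcal{P}$ is the set of outcomes. Given $\sigma$, bus $j$ starts at $s$, visits exactly the players $i$ with $\sigma_i=j$, in the order in which they appear in $\pi_j$, and ends at $t$. Let $n_j=|\{i:\sigma_i=j\}|$, let $p^j_i$ be the $i$-th player visited by bus $j$, and put $p^j_{n_j+1}=t$. The cost of the player $p^j_k$ is $c_{p^j_k}(\sigma)=\sum_{l=k}^{n_j} d(p^j_l,p^j_{l+1})$, the distance travelled by her bus from her location to $t$. The utilitarian social cost function is $U(\sigma)=\sum_{i\in N}c_i(\sigma)$.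 Sequential version. Players choose buses in the order $1,2,\dots,n$, each observing all earlier choices. A strategy of player $i$ is a function $\lambda_i$ assigning a bus to each possible history $\sigma_{<i}=(\sigma_1,\dots,\sigma_{i-1})\in M^{i-1}$; a strategy profile is $\lambda=(\lambda_1,\dots,\lambda_n)$. Its outcome is the $\sigma$ with $\sigma_i=\lambda_i(\sigma_{<i})$ for all $i$. A strategy profile $\lambda$ is a subgame perfect equilibrium (SPE) if for every player $i$ and every history $\sigma_{<i}$, player $i$ cannot decrease her cost by choosing a bus other than $\lambda_i(\sigma_{<i})$ after the history $\sigma_{<i}$, when players $i+1,\dots,n$ then play according to $\lambda_{i+1},\dots,\lambda_n$. An SPE always exists. For a social cost function $f$, $f(\lambda)$ denotes $f$ of the outcome of $\lambda$. With $\sigma^*\in\mathcal{P}$ minimizing $f$, $\mathrm{SPoS}(f,\Gamma)=\min_{\lambda\in \mathrm{SPE}(\Gamma)} f(\lambda)/f(\sigma^* )$, and for a class $\mathcal{G}$ of games $\mathrm{SPoS}(f,\mathcal{G})=\sup_{\Gamma\in\mathcal{G}}\mathrm{SPoS}(f,\Gamma)$, the supremum being over the $\Gamma\in\mathcal{G}$ with $f(\sigma^* )>0$. *)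

(* Defs.v *)
From HB Require Import structures.
From mathcomp Require Import all_boot all_order all_algebra all_fingroup.
From mathcomp Require Import all_classical all_reals all_analysis.

Set Implicit Arguments.
Unset Strict Implicit.
Unset Printing Implicit Defensive.

Import Order.TTheory GRing.Theory Num.Theory.
Local Open Scope classical_set_scope.
Local Open Scope ring_scope.

Inductive vertex (n : nat) : Type :=
  | Source : vertex n
  | Dest : vertex n
  | Player : 'I_n -> vertex n.

Arguments Source {n}.
Arguments Dest {n}.

(* [bus_order j k] is the player in position [k] of the permutation of bus [j]. *)
Record game (R : realType) (n m : nat) : Type := Game {
  dist : vertex n -> vertex n -> R;
  bus_order : 'I_m -> 'S_n;
  dist_ge0 : forall x y, 0 <= dist x y;
  dist_sym : forall x y, dist x y = dist y x;
  dist_refl : forall x, dist x x = 0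
}.

Definition metric (R : realType) (n m : nat) (G : game R n m) : Prop :=
  forall x y w, dist G x w <= dist G x y + dist G y w.

Definition same_permutation (R : realType) (n m : nat) (G : game R n m) : Prop :=
  forall j k : 'I_m, bus_order G j = bus_order G k.

Definition outcome (n m : nat) := {ffun 'I_n -> 'I_m}.

Definition route (R : realType) (n m : nat) (G : game R n m)
    (sigma : outcome n m) (j : 'I_m) : seq 'I_n :=
  [seq i <- [seq bus_order G j k | k <- enum 'I_n] | sigma i == j].

(* The default of [nth] makes the stop following the last player [Dest]. *)
Definition stop (R : realType) (n m : nat) (G : game R n m)
    (sigma : outcome n m) (j : 'I_m) (l : nat) : vertex n :=
  nth Dest [seq Player i | i <- route G sigma j] l.

Definition cost (R : realType) (n m : nat) (G : game R n m)
    (sigma : outcome n m) (i : 'I_n) : R :=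
  let r := route G sigma (sigma i) in
  \sum_(index i r <= l < size r)
    dist G (stop G sigma (sigma i) l) (stop G sigma (sigma i) l.+1).

Definition social_cost (R : realType) (n m : nat) :=
  game R n m -> outcome n m -> R.

Definition utilitarian (R : realType) (n m : nat) : social_cost R n m :=
  fun G sigma => \sum_(i < n) cost G sigma i.

(* Players are numbered from 0, so player [i] observes [i] earlier choices. *)
Definition profile (n m : nat) := forall i : 'I_n, i.-tuple 'I_m -> 'I_m.

Definition history (n m : nat) (sigma : outcome n m) (i : 'I_n) : i.-tuple 'I_m :=
  [tuple sigma (widen_ord (ltnW (ltn_ord i)) l) | l < i].

Definition follows_from (n m : nat) (lambda : profile n m) (k : nat)
    (sigma : outcome n m) : Prop :=
  forall i : 'I_n, (k <= i)%N -> sigma i = lambda i (history sigma i).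

Lemma history_ext (n m : nat) (i : 'I_n) (sigma tau : outcome n m) :
  (forall l : 'I_n, (l < i)%N -> sigma l = tau l) ->
  history sigma i = history tau i.
Proof.
move=> H; apply: eq_from_tnth => l; rewrite !tnth_mktuple; apply: H.
exact: (ltn_ord l).
Qed.

(* Every profile can be played in exactly one way after every history. *)
Lemma follows_from_exists_unique (n m : nat) (lambda : profile n m) (k : nat)
    (sigma0 : outcome n m) :
  exists! sigma : outcome n m,
    (forall i : 'I_n, (i < k)%N -> sigma i = sigma0 i) /\
    follows_from lambda k sigma.
Proof.
have step q : exists sigma : outcome n m,
    (forall i : 'I_n, (i < k)%N -> sigma i = sigma0 i) /\
    (forall i : 'I_n, (k <= i < q)%N -> sigma i = lambda i (history sigma i)).
  elim: q => [|p [sigma [s0 s1]]].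
    by exists sigma0; split => // i; rewrite ltn0 andbF.
  exists [ffun i : 'I_n => if (k <= i)%N && (i == p :> nat)
            then lambda i (history sigma i) else sigma i].
  have hE (i : 'I_n) : (i <= p)%N -> history [ffun i : 'I_n =>
      if (k <= i)%N && (i == p :> nat)
      then lambda i (history sigma i) else sigma i] i = history sigma i.
    move=> ip; apply: history_ext => l li; rewrite ffunE.
    by rewrite (ltn_eqF (leq_trans li ip)) andbF.
  split=> i; first by move=> ik; rewrite ffunE leqNgt ik /= s0.
  move=> /andP[ki]; rewrite ltnS => ip; rewrite hE // ffunE ki /=.
  by case: eqP => // /eqP np; apply: s1; rewrite ki ltn_neqAle np.
have [sigma [s0 s1]] := step n.
exists sigma; split.
  by split=> // i ki; apply: s1; rewrite ki ltn_ord.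
move=> tau [t0 t1]; apply/ffunP => i.
have [p ip] := ubnP (nat_of_ord i); elim: p i ip => // p IH i ip.
have [ik|ki] := ltnP i k; first by rewrite s0 // t0.
rewrite s1 ?ki ?ltn_ord // t1 //; congr (lambda i _).
by apply: history_ext => l li; apply: IH; apply: leq_trans li _.
Qed.

Definition outcome_of (n m : nat) (lambda : profile n m)
    (sigma : outcome n m) : Prop :=
  follows_from lambda 0 sigma.

(* After the history [h], [sigma] results from [lambda], and [tau] from player
   [i] choosing an arbitrary bus and the later players following [lambda]. *)
Definition SPE (R : realType) (n m : nat) (G : game R n m)
    (lambda : profile n m) : Prop :=
  forall (i : 'I_n) (h : i.-tuple 'I_m) (sigma tau : outcome n m),
    history sigma i = h -> follows_from lambda i sigma ->
    history tau i = h -> follows_from lambda i.+1 tau ->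
    cost G sigma i <= cost G tau i.

(* The minima below range over finite nonempty sets, hence are written [inf]. *)
Definition optimum (R : realType) (n m : nat) (f : social_cost R n m)
    (G : game R n m) : R :=
  inf [set f G sigma | sigma in [set: outcome n m]].

Definition SPoS (R : realType) (n m : nat) (f : social_cost R n m)
    (G : game R n m) : R :=
  inf [set f G sigma / optimum f G | sigma in
        [set sigma | exists lambda, SPE G lambda /\ outcome_of lambda sigma]].

Definition SPoS_class (R : realType) (n m : nat) (f : social_cost R n m)
    (C : set (game R n m)) : \bar R :=
  ereal_sup [set (SPoS f G)%:E | G in [set G | C G /\ 0 < optimum f G]].

(* Main.v *)
(* The first m players to move are "far": at distance 1 from t and eps from each
   other, all remaining vertices being at t. Every bus visits the players in
   the reverse of the order of play, so a cost depends only on moves already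
   made. Hence every subgame perfect equilibrium is myopic: a far player takes
   a bus without earlier far players, since sharing costs her an extra eps. So,
   if n >= m, each bus carries a far player, and each other player pays at least
   2 for the detour to her, giving U >= m + 2 (n - m). Putting all the far
   players on one bus and the others on another costs at most m + eps n^2, and
   eps tends to 0. For n < m, m is replaced by the number K = n of far players,
   and 2 n / K - 1 >= 2 n / m - 1. *)
Require Import Defs.
From mathcomp Require Import all_boot all_order all_algebra all_fingroup.
From mathcomp Require Import all_classical all_reals all_analysis.
From mathcomp Require Import ring lra.
Set Implicit Arguments.
Unset Strict Implicit.
Unset Printing Implicit Defensive.
Import Order.TTheory GRing.Theory Num.Theory.
Local Open Scope classical_set_scope.
Local Open Scope ring_scope.

(** * Costs as lengths of paths *)

Fixpoint path_length (R : realType) (n m : nat) (G : game R n m)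
    (x : vertex n) (s : seq (vertex n)) : R :=
  if s is y :: s' then dist G x y + path_length G y s' else 0.

Definition visited_after (R : realType) (n m : nat) (G : game R n m)
    (sigma : outcome n m) (i : 'I_n) : seq 'I_n :=
  let r := route G sigma (sigma i) in drop (index i r).+1 r.

(** The default [z] of [nth] plays the endpoint at [l = size s], just as the default [Dest] does in
    [stop]. *)
Lemma path_length_rcons_sum (R : realType) (n m : nat) (G : game R n m)
    (x z : vertex n) (s : seq (vertex n)) :
  path_length G x (rcons s z) =
  \sum_(0 <= l < (size s).+1) dist G (nth z (x :: s) l) (nth z s l).
Proof.
elim: s x => [|y s IH] x /=; first by rewrite big_nat1 addr0.
by rewrite IH [RHS]big_nat_recl.
Qed.

Lemma mem_route (R : realType) (n m : nat) (G : game R n m)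
    (sigma : outcome n m) (i : 'I_n) : i \in route G sigma (sigma i).
Proof.
rewrite mem_filter eqxx /=; apply/mapP.
by exists ((bus_order G (sigma i))^-1%g i); rewrite ?mem_enum // permKV.
Qed.

Lemma cost_path_length (R : realType) (n m : nat) (G : game R n m)
    (sigma : outcome n m) (i : 'I_n) :
  cost G sigma i =
  path_length G (Player i) (rcons (map (@Player n) (visited_after G sigma i)) Dest).
Proof.
rewrite path_length_rcons_sum size_map /cost /visited_after /stop.
have := mem_route G sigma i; set r := route _ _ _ => ir.
have Dr : drop (index i r) r = i :: drop (index i r).+1 r.
  by rewrite (drop_nth i) ?index_mem // nth_index.
have -> : size r = ((size (drop (index i r).+1 r)).+1 + index i r)%N.
  by rewrite size_drop -subSn ?index_mem // subSS subnK // index_size.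
rewrite -{1}[index i r]add0n big_addn addnK; apply: eq_bigr => l _.
congr (dist G _ _).
  by rewrite addnC -nth_drop -map_drop Dr.
by rewrite -addSn addnC -nth_drop -map_drop Dr.
Qed.

(** * Lower bounds on costs from the triangle inequality *)

Section Metric.
Variables (R : realType) (n m : nat) (G : game R n m).
Hypothesis metG : metric G.

Lemma path_length_ge (x z : vertex n) (s : seq (vertex n)) :
  dist G x z <= path_length G x (rcons s z).
Proof.
elim: s x => [|y s IH] x /=; first by rewrite addr0.
by apply: le_trans (metG x y z) _; rewrite lerD2l.
Qed.

Lemma cost_ge_dist (sigma : outcome n m) (i : 'I_n) :
  dist G (Player i) Dest <= cost G sigma i.
Proof. by rewrite cost_path_length path_length_ge. Qed.

Lemma cost_ge_detour (sigma : outcome n m) (i l : 'I_n) :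
  l \in visited_after G sigma i ->
  dist G (Player i) (Player l) + dist G (Player l) Dest <= cost G sigma i.
Proof.
rewrite cost_path_length; set x := Player i; elim: (visited_after _ _ _) x => // a s IH x.
rewrite inE => /predU1P[<-|ls] /=; first by rewrite lerD2l path_length_ge.
apply: le_trans (_ : dist G x (Player a) + (dist G (Player a) (Player l) + dist G (Player l) Dest) <= _).
  by rewrite addrA lerD2r metG.
by rewrite lerD2l IH.
Qed.
End Metric.

(** Turns positions on a route into a condition on the order of play, for buses that visit later
    movers first. *)
Lemma drop_index_sorted_gt (n : nat) (s : seq 'I_n) (i : 'I_n) :
  sorted (fun k l : 'I_n => (l < k)%N) s -> i \in s ->
  drop (index i s).+1 s = [seq l : 'I_n <- s | (l < i)%N].
Proof.
have tr : transitive (fun k l : 'I_n => (l < k)%N).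
  by move=> b a c ba cb; apply: ltn_trans cb ba.
elim: s => // a s IH /= pas.
have /allP all_lt := order_path_min tr pas.
rewrite inE eq_sym; case: eqVneq => [Dai|_] /= is_.
  by rewrite Dai ltnn drop0 -Dai; apply/esym/all_filterP/allP.
by rewrite ltnNge (ltnW (all_lt _ is_)) /= IH // (path_sorted pas).
Qed.

(** * The bad game and its equilibria *)

Section BadGame.
Variables (R : realType) (n m : nat) (eps : R).
Hypotheses (eps_gt0 : 0 < eps) (eps_le1 : eps <= 1).

(* Vertices labelled [None] are all located at the destination. *)
Definition far_label (v : vertex n) : option 'I_n :=
  if v is Player i then if (i < m)%N then Some i else None else None.

Definition bad_dist (x y : vertex n) : R :=
  match far_label x, far_label y with
  | None, None => 0
  | Some i, Some j => if i == j then 0 else eps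
  | _, _ => 1
  end.

Lemma bad_dist_ge0 x y : 0 <= bad_dist x y.
Proof.
rewrite /bad_dist; case: (far_label x) (far_label y) => [i|] [j|] //.
by case: ifP => // _; apply: ltW.
Qed.

Lemma bad_dist_sym x y : bad_dist x y = bad_dist y x.
Proof.
by rewrite /bad_dist; case: (far_label x) (far_label y) => [i|] [j|] //; rewrite eq_sym.
Qed.

Lemma bad_dist_refl x : bad_dist x x = 0.
Proof. by rewrite /bad_dist; case: (far_label x) => // i; rewrite eqxx. Qed.

Definition bad_game : game R n m :=
  Game (fun _ => perm (@rev_ord_inj n)) bad_dist_ge0 bad_dist_sym bad_dist_refl.

Lemma bad_game_metric : metric bad_game.
Proof.
move=> x y w; rewrite /= /bad_dist; have eps_ge0 := ltW eps_gt0.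
(* The bound [eps <= 1] serves the detour between two far players through a vertex at the
   destination: [eps <= 1 + 1]. *)
case: (far_label x) (far_label y) (far_label w) => [i|] [j|] [k|];
  try (by repeat (case: ifP => _); rewrite ?add0r ?addr0 ?lerDl ?lerDr ?addr_ge0 //;
    apply: le_trans eps_le1 _; rewrite lerDl).
by case: (eqVneq i j) => ?; case: (eqVneq j k) => ?; subst;
  rewrite ?eqxx; repeat (case: ifP => _); rewrite ?add0r ?addr0 ?lerDl ?addr_ge0.
Qed.

Lemma bad_game_visited_after (sigma : outcome n m) (i : 'I_n) :
  visited_after bad_game sigma i =
  [seq l : 'I_n <- [seq rev_ord k | k <- enum 'I_n] | (l < i)%N && (sigma l == sigma i)].
Proof.
have rE : route bad_game sigma (sigma i) =
    [seq l : 'I_n <- [seq rev_ord k | k <- enum 'I_n] | sigma l == sigma i].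
  by rewrite /route; under eq_map => k do rewrite permE.
rewrite /visited_after drop_index_sorted_gt ?mem_route ?rE -?filter_predI //.
apply: sorted_filter => [b a c ba cb|]; first exact: ltn_trans cb ba.
rewrite sorted_map; have := iota_ltn_sorted 0 n.
rewrite -val_enum_ord sorted_map; apply: sub_sorted => a b /= ab.
by rewrite ltn_sub2l //; apply: leq_ltn_trans (ltn_ord b).
Qed.

Lemma mem_bad_game_visited_after (sigma : outcome n m) (i l : 'I_n) :
  (l \in visited_after bad_game sigma i) = (l < i)%N && (sigma l == sigma i).
Proof.
rewrite bad_game_visited_after mem_filter -[l in X in _ && X]rev_ordK.
by rewrite map_f ?mem_enum ?andbT.
Qed.

(* Buses visit players in the reverse of the order of play, so the later
   movers on a bus are picked up earlier and do not affect [i]. *)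
Lemma bad_game_cost_local (sigma tau : outcome n m) (i : 'I_n) :
  (forall l : 'I_n, (l <= i)%N -> sigma l = tau l) ->
  cost bad_game sigma i = cost bad_game tau i.
Proof.
move=> st; rewrite !cost_path_length !bad_game_visited_after.
congr (path_length _ _ (rcons (map _ _) _)); apply: eq_filter => l.
by case: ltnP => //= li; rewrite !st // ltnW.
Qed.

(** As [h] has size [i], the default [j] is the bus of player [i]. The later players get it too,
    which by locality does not change the cost of [i]. *)
Definition extend_history (i : 'I_n) (h : i.-tuple 'I_m) (j : 'I_m) : outcome n m :=
  [ffun k : 'I_n => nth j h k].

Lemma extend_history_cost (sigma : outcome n m) (i : 'I_n) :
  cost bad_game sigma i =
  cost bad_game (extend_history (history sigma i) (sigma i)) i.
Proof.
apply: bad_game_cost_local => l; rewrite ffunE leq_eqVlt => /orP[/eqP li|li].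
  by rewrite nth_default ?size_tuple ?li //; congr (sigma _); apply: val_inj.
rewrite -[l : nat]/(nat_of_ord (Ordinal li)) -tnth_nth tnth_mktuple.
by congr (sigma _); apply: val_inj.
Qed.

(** By locality, the history and her own bus determine a player's cost, so greedy play is an
    equilibrium. *)
Lemma bad_game_SPE_exists (j0 : 'I_m) : exists lambda, SPE bad_game lambda.
Proof.
exists (fun i h => [arg min_(j < j0) cost bad_game (extend_history h j) i]%O).
move=> i h sigma tau hs fs ht _.
rewrite (extend_history_cost sigma) (extend_history_cost tau) hs ht.
rewrite (fs i (leqnn i)) hs; case: arg_minP => // j _ jmin.
exact: jmin.
Qed.

Lemma far_dist_Dest (i : 'I_n) : (i < m)%N -> dist bad_game (Player i) Dest = 1.
Proof. by move=> im; rewrite /= /bad_dist /= im. Qed.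

Lemma cost_far_ge1 (sigma : outcome n m) (i : 'I_n) : (i < m)%N ->
  1 <= cost bad_game sigma i.
Proof. by move=> im; rewrite -(far_dist_Dest im) cost_ge_dist //; apply: bad_game_metric. Qed.

(** Pigeonhole: fewer than [m] players have moved. *)
Lemma unused_bus (sigma : outcome n m) (i : 'I_n) : (i < m)%N ->
  exists j, forall l : 'I_n, (l < i)%N -> sigma l != j.
Proof.
move=> im; pose A := [set sigma (widen_ord (ltnW (ltn_ord i)) l) | l : 'I_i]%SET.
have : ~: A != finset.set0.
  rewrite -card_gt0 cardsCs finset.setCK card_ord subn_gt0.
  by apply: leq_ltn_trans (leq_imset_card _ _) _; rewrite card_ord.
case/set0Pn => j; rewrite inE => jA; exists j => l li.
apply: contraNneq jA => <-; apply/imsetP; exists (Ordinal li) => //.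
by congr (sigma _); apply: val_inj.
Qed.

Lemma SPE_far_separate (lambda : profile n m) (sigma : outcome n m) :
  SPE bad_game lambda -> outcome_of lambda sigma ->
  forall l i : 'I_n, (l < i)%N -> (i < m)%N -> sigma l != sigma i.
Proof.
move=> spe out l i li im; apply/eqP => sli.
have [j jP] := unused_bus sigma im.
have [tau [[t0 t1] _]] := follows_from_exists_unique lambda i.+1
  [ffun k : 'I_n => if k == i then j else sigma k].
have ti : tau i = j by rewrite t0 // ffunE eqxx.
have tl (k : 'I_n) : (k < i)%N -> tau k = sigma k.
  by move=> ki; rewrite t0 ?ltnS 1?ltnW // ffunE; case: eqP ki => // ->; rewrite ltnn.
have ht : history tau i = history sigma i by apply: history_ext.
have := spe i _ sigma tau erefl (fun k _ => out k isT) ht t1.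
apply/negP; rewrite -ltNge.
have -> : cost bad_game tau i = 1.
  rewrite cost_path_length.
  have -> : visited_after bad_game tau i = [::].
    rewrite bad_game_visited_after -(filter_pred0 [seq rev_ord k | k <- enum 'I_n]).
    apply: eq_filter => k /=; case: ltnP => //= ki.
    by rewrite ti tl // (negPf (jP _ ki)).
  by rewrite [LHS]addr0 far_dist_Dest.
have lv : l \in visited_after bad_game sigma i.
  by rewrite mem_bad_game_visited_after li sli eqxx.
apply: lt_le_trans (cost_ge_detour bad_game_metric lv).
rewrite (far_dist_Dest (ltn_trans li im)) /= /bad_dist /= im (ltn_trans li im).
by case: eqP li => [->|_ _]; rewrite ?ltnn // ltrDr.
Qed.

(** The first [m] movers sit on distinct buses, hence on all of them. The far player on the bus of
    [i] moved earlier, so she is visited after [i]. *)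
Lemma SPE_near_ge2 (lambda : profile n m) (sigma : outcome n m) (i : 'I_n) :
  SPE bad_game lambda -> outcome_of lambda sigma -> (m <= i)%N ->
  2 <= cost bad_game sigma i.
Proof.
move=> spe out mi.
have mn : (m <= n)%N := leq_trans mi (ltnW (ltn_ord i)).
pose g (k : 'I_m) := sigma (widen_ord mn k).
have injg : injective g.
  have neq (a b : 'I_m) : (a < b)%N -> g a != g b.
    by move=> ab; apply: (SPE_far_separate spe out) => //=; apply: ltn_ord.
  move=> a b gab; apply: val_inj; case: (ltngtP (a : nat) b) => // /neq.
    by rewrite gab eqxx.
  by rewrite gab eqxx.
have /codomP[k sk] := inj_card_onto injg (leqnn _) (sigma i).
have kv : widen_ord mn k \in visited_after bad_game sigma i.
  by rewrite mem_bad_game_visited_after sk eqxx andbT (leq_trans (ltn_ord k)).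
apply: le_trans (cost_ge_detour bad_game_metric kv).
by rewrite far_dist_Dest //= /bad_dist /= ltn_ord ltnNge mi.
Qed.

(** * Equilibrium cost against the optimum *)

Definition far_players : {set 'I_n} := [set i : 'I_n | (i < m)%N]%SET.

Lemma SPE_utilitarian_ge (lambda : profile n m) (sigma : outcome n m) :
  SPE bad_game lambda -> outcome_of lambda sigma ->
  2 * n%:R - #|far_players|%:R <= utilitarian bad_game sigma.
Proof.
move=> spe out.
have -> : 2 * n%:R - #|far_players|%:R = \sum_(i < n) (2 - (i \in far_players)%:R) :> R.
  rewrite sumrB sumr_const card_ord mulr_natr -natr_sum; congr (_ - _%:R).
  by rewrite -sum1_card big_mkcond.
apply: ler_sum => i _; rewrite inE; case: ltnP => im.
  by apply: le_trans (cost_far_ge1 _ im); rewrite -[2]natr1 addrK.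
by rewrite subr0 (SPE_near_ge2 spe out).
Qed.

Lemma utilitarian_grouped (j0 j1 : 'I_m) : j0 != j1 ->
  exists sigma, utilitarian bad_game sigma <=
    #|far_players|%:R + eps * (n%:R * n%:R).
Proof.
move=> j01; exists [ffun i : 'I_n => if (i < m)%N then j0 else j1].
set sigma := finfun _.
have -> : #|far_players|%:R + eps * (n%:R * n%:R) =
    \sum_(i < n) ((i \in far_players)%:R + eps * n%:R).
  rewrite big_split /= sumr_const card_ord -mulrnAr -[n%:R *+ n]mulr_natr -natr_sum.
  by congr (_%:R + _); rewrite -sum1_card big_mkcond.
apply: ler_sum => i _; rewrite cost_path_length inE.
have en0 : 0 <= eps * n%:R by rewrite mulr_ge0 // ltW.
have same (l : 'I_n) : l \in visited_after bad_game sigma i -> (l < m)%N = (i < m)%N.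
  rewrite mem_bad_game_visited_after => /andP[_]; rewrite !ffunE.
  by do 2 case: ifP => //; rewrite ?(negPf j01) // eq_sym (negPf j01).
have sz : (size (visited_after bad_game sigma i) <= n)%N.
  rewrite bad_game_visited_after size_filter; apply: leq_trans (count_size _ _) _.
  by rewrite size_map size_enum_ord.
apply: le_trans (_ : (i < m)%N%:R + eps * (size (visited_after bad_game sigma i))%:R <= _); last first.
  by rewrite lerD2l ler_wpM2l ?ler_nat // ltW.
(* The start [b] varies among players of the same kind as the stops: each leg between players costs
   at most [eps], and the last leg costs 1 or 0 according to the kind. *)
elim: (visited_after bad_game sigma i) {2 3 5}i same => [|a s IH] b sameb.
  by rewrite /= /bad_dist /= mulr0 !addr0; case: ifP.
have am : (a < m)%N = (b < m)%N by apply: sameb; rewrite mem_head.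
rewrite /= -[(size s).+1%:R]natr1 mulrDr mulr1 addrA [leRHS]addrC -am lerD //; last first.
  by apply: IH => l ls; rewrite am sameb // inE ls orbT.
rewrite /bad_dist /= am; case: ifP => _; last exact: ltW.
by case: ifP => // _; apply: ltW.
Qed.

Lemma utilitarian_ge1 (sigma : outcome n m) :
  (0 < n)%N -> 1 <= utilitarian bad_game sigma.
Proof.
move=> n_gt0; pose i0 := Ordinal n_gt0.
(* The bus [sigma i0] witnesses [0 < m], so the first mover is far. *)
have im : (i0 < m)%N := leq_ltn_trans (leq0n _) (ltn_ord (sigma i0)).
rewrite /utilitarian (bigD1 i0) //= -[leLHS]addr0 lerD ?cost_far_ge1 //.
apply: sumr_ge0 => i _; apply: le_trans (cost_ge_dist bad_game_metric _ _).
exact: dist_ge0.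
Qed.

Lemma bad_game_optimum_bounds : (0 < n)%N -> (2 <= m)%N ->
  1 <= optimum (@utilitarian R n m) bad_game <=
    #|far_players|%:R + eps * (n%:R * n%:R).
Proof.
move=> n_gt0 m_ge2.
have [sigma sP] := @utilitarian_grouped (Ordinal (ltnW m_ge2)) (Ordinal m_ge2) isT.
have lb1 : lbound [set utilitarian bad_game tau | tau in [set: outcome n m]] 1.
  by move=> _ [tau _ <-]; apply: utilitarian_ge1.
apply/andP; split.
  by apply: lb_le_inf => //; exists (utilitarian bad_game sigma); exists sigma.
by apply: le_trans sP; apply: ge_inf; [exists 1|exists sigma].
Qed.

Lemma card_far_players_gt0 : (0 < n)%N -> (0 < m)%N -> (0 < #|far_players|)%N.
Proof. by move=> n_gt0 m_gt0; apply/card_gt0P; exists (Ordinal n_gt0); rewrite inE. Qed.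

Lemma card_far_players_le_n : (#|far_players| <= n)%N.
Proof. by rewrite -[leqRHS]card_ord max_card. Qed.

Lemma card_far_players_le_m : (0 < m)%N -> (#|far_players| <= m)%N.
Proof.
move=> m_gt0; rewrite -[leqRHS]card_ord.
(* On far players the default of [insubd] never occurs. *)
have inj : {in far_players &, injective (fun i : 'I_n => insubd (Ordinal m_gt0) (i : nat))}.
  move=> a b; rewrite !inE => am bm /(congr1 val) /=.
  by rewrite !val_insubd am bm => /val_inj.
by rewrite -(card_in_imset inj) max_card.
Qed.

Lemma bad_game_SPoS_ge : (0 < n)%N -> (2 <= m)%N ->
  (2 * n%:R - #|far_players|%:R) / (#|far_players|%:R + eps * (n%:R * n%:R)) <=
  SPoS (@utilitarian R n m) bad_game.
Proof.
move=> n_gt0 m_ge2; have /andP[opt1 opt2] := bad_game_optimum_bounds n_gt0 m_ge2.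
have opt_gt0 : 0 < optimum (@utilitarian R n m) bad_game := lt_le_trans ltr01 opt1.
have [lambda spe] := bad_game_SPE_exists (Ordinal m_ge2).
apply: lb_le_inf => [|_ [sigma [mu [spe_mu out]] <-]].
  (* A lower bound passes to [inf] only for a nonempty set; the greedy equilibrium supplies an
     outcome. The prescribed prefix is empty, so the constant map is arbitrary. *)
  have [sigma [[_ out] _]] :=
    follows_from_exists_unique lambda 0 [ffun => Ordinal m_ge2].
  by eexists; exists sigma; first by exists lambda.
have num_ge := SPE_utilitarian_ge spe_mu out.
apply: ler_pM => //.
- have : #|far_players|%:R <= n%:R :> R by rewrite ler_nat card_far_players_le_n.
  by have := ler0n R n; lra.
- by rewrite invr_ge0 (le_trans (ltW opt_gt0)).
- by rewrite lef_pV2 // posrE // (lt_le_trans opt_gt0).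
Qed.
End BadGame.

(** * Letting [eps] tend to 0 *)

Theorem proposition3p6 (R : realType) (n m : nat) (hn : (1 <= n)%N) (hm : (2 <= m)%N) :
  ((2 * (n%:R / m%:R) - 1)%:E <=
    SPoS_class (@utilitarian R n m)
      [set G : game R n m | metric G /\ same_permutation G])%E.
Proof.
apply/lee_addgt0Pr => e e_gt0.
set k : R := #|far_players n m|%:R.
have k1 : 1 <= k by rewrite ler1n card_far_players_gt0 // ltnW.
have km : k <= m%:R by rewrite ler_nat card_far_players_le_m // ltnW.
have n1 : 1 <= n%:R :> R by rewrite ler1n.
have n3_gt0 : 0 < 2 * n%:R ^+ 3 :> R by rewrite mulr_gt0 // exprn_gt0 // (lt_le_trans ltr01).
(* The excess in the optimum is at most [x = eps * n^2], and it will lower the ratio by at most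
   [2 * n * x], which this choice keeps below [e]. *)
pose eps : R := Num.min 1 (e / (2 * n%:R ^+ 3)).
have eps_gt0 : 0 < eps by rewrite lt_min ltr01 divr_gt0.
have eps_le1 : eps <= 1 by rewrite ge_min lexx.
have eps_e : eps * (2 * n%:R ^+ 3) <= e by rewrite -ler_pdivlMr // ge_min lexx orbT.
have /andP[opt1 _] := bad_game_optimum_bounds eps_gt0 eps_le1 hn hm.
have sup_ge : ((SPoS (@utilitarian R n m) (bad_game n m eps_gt0))%:E <=
    SPoS_class (@utilitarian R n m) [set G | metric G /\ same_permutation G])%E.
  apply: ereal_sup_ubound; exists (bad_game n m eps_gt0) => //.
  by split; [split=> //; apply: bad_game_metric|apply: lt_le_trans opt1].
apply: le_trans (leeD2r _ sup_ge); rewrite -EFinD lee_fin.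
apply: le_trans (lerD (bad_game_SPoS_ge eps_gt0 eps_le1 hn hm) (lexx e)).
rewrite -/k; set x := eps * _.
have x_ge0 : 0 <= x by rewrite !mulr_ge0 // ltW.
have xe : 2 * n%:R * x <= e by rewrite (le_trans _ eps_e) // /x; lra.
(* Reduces the target to [2 * n / k - 1], covering [n < m] as well. *)
have nm : n%:R / m%:R <= n%:R / k :> R by rewrite ler_wpM2l // lef_pV2 // posrE; lra.
(* Since [k >= 1], the inverse drops by at most [x] on passing from [k] to [k + x]. *)
have kx : (k + x)^-1 + x >= k^-1.
  rewrite -subr_ge0.
  have -> : (k + x)^-1 + x - k^-1 = x * (k * (k + x) - 1) / (k * (k + x)).
    by field; rewrite !gt_eqF //; lra.
  by rewrite divr_ge0 ?mulr_ge0 //; nra.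
have kk : k / k = 1 by rewrite divff // gt_eqF //; lra.
have kn : k <= n%:R by rewrite ler_nat card_far_players_le_n.
(* The left side is [2 * n / k - 1]; on the right, the error [(2 * n - k) * x] is at most
   [2 * n * x <= e]. *)
have : (2 * n%:R - k) * k^-1 <= (2 * n%:R - k) * ((k + x)^-1 + x).
  by rewrite ler_wpM2l //; lra.
nra.
Qed.
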